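(* Let $\pi\colon (T,X)\to (T,Y)$ be an extension of minimal compact semiflows, where $T$ is a discrete monoid (in particular this covers the case that $T$ is a discrete group). Suppose $L\subseteq \mathtt{R}_\pi$ is a closed $T$-invariant AP-transitive relation for $\pi$ on $X$ such that (a) $L$ contains a dense set of a.p. points of the semiflow $(T,L)$, and (b) $\mathtt{RP}_{\pi|L}=L$. Then $(T,L)$ is an M-semiflow, i.e. it is topologically transitive and has a dense set of a.p. points.
   Context: An extension $\pi\colon(T,X)\to(T,Y)$ is a continuous surjection with $\pi(tx)=t\pi(x)$ for all $t\in T$, $x\in X$. Put $\mathtt{R}_\pi=\{(x_1,x_2)\in X\times X:\pi x_1=\pi x_2\}$, on which $T$ acts diagonally, and let $\Delta_X$ denote the diagonal of $X\times X$. A subset $A\subseteq T$ is syndetic if there is a compact (here: finite) $K\subseteq T$ with $Kt\cap A\neq\emptyset$ for all $t\in T$. A point $z$ of a dynamic $(T,Z)$ is almost periodic (a.p.) if $\{t\in T: tz\in U\}$ is syndetic for every neighborhood $U$ of $z$. A dynamic $(T,Z)$ is topologically transitive (T.T.) if for all nonempty open $U,V\subseteq Z$ there is $t\in T$ with $V\cap tU\neq\emptyset$. A dynamic is an M-dynamic (M-semiflow, M-flow) if it is T.T. and has a dense set of a.p. points. A nonempty set $L\subseteq\mathtt{R}_\pi$ is an AP-transitive relation for $\pi$ on $X$ if $L$ is reflexive and symmetric as a relation on $X$, and whenever $(x_1,x_2)\in L$ and $(x_2,x_3)\in L$ are both a.p. points of $(T,X\times X)$, then $(x_1,x_3)\in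 L$. For $L\subseteq\mathtt{R}_\pi$, $\mathtt{RP}_{\pi|L}$ is the set of $\tilde x\in L$ for which there exist nets $\tilde x_j\in L$, $t_j\in T$ and a point $\tilde x'\in\Delta_X$ with $\tilde x_j\to\tilde x$ and $t_j\tilde x_j\to\tilde x'$. *)

(* Defs.v *)
From HB Require Import structures.
From mathcomp Require Import all_boot all_order.
From mathcomp Require Import all_classical all_reals all_analysis.
Set Implicit Arguments. Unset Strict Implicit. Unset Printing Implicit Defensive.
Import boolp.
Local Open Scope classical_set_scope.

(* A discrete monoid (T, mul, e) is given by explicit operations; its
   axioms are assumed in the theorem.  A semiflow of T on a space Z is a map
   act : T -> Z -> Z with act e = id, act (s*t) = act s \o act t, and each
   act t continuous (T is discrete). *)

Definition monoid_axioms (T : Type) (mul : T -> T -> T) (e : T) : Prop :=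
  (forall a b c, mul a (mul b c) = mul (mul a b) c) /\
  (forall a, mul e a = a) /\ (forall a, mul a e = a).

Definition semiflow (T : Type) (mul : T -> T -> T) (e : T) (Z : topologicalType)
  (act : T -> Z -> Z) : Prop :=
  (forall z, act e z = z) /\
  (forall s t z, act (mul s t) z = act s (act t z)) /\
  (forall t, continuous (act t)).

Definition sf_invariant (T : Type) (Z : Type) (act : T -> Z -> Z) (A : set Z) : Prop :=
  forall t z, A z -> A (act t z).

Definition sf_minimal (T : Type) (Z : topologicalType) (act : T -> Z -> Z) : Prop :=
  forall A : set Z, closed A -> sf_invariant act A -> A !=set0 -> A = setT.

Definition sf_extension (T : Type) (X Y : topologicalType)
  (actX : T -> X -> X) (actY : T -> Y -> Y) (pi : X -> Y) : Prop :=
  continuous pi /\ (forall y, exists x, pi x = y) /\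
  (forall t x, pi (actX t x) = actY t (pi x)).

Definition Rpi (X Y : Type) (pi : X -> Y) : set (X * X) :=
  [set p | pi p.1 = pi p.2].

Definition sf_diagonal (X : Type) : set (X * X) := [set p | p.1 = p.2].

Definition diag_act (T X : Type) (act : T -> X -> X) (t : T) (p : X * X) : X * X :=
  (act t p.1, act t p.2).

Definition sf_syndetic (T : Type) (mul : T -> T -> T) (A : set T) : Prop :=
  exists K : set T, finite_set K /\ forall t, exists2 k, K k & A (mul k t).

Definition ap_point (T : Type) (mul : T -> T -> T) (Z : topologicalType)
  (act : T -> Z -> Z) (z : Z) : Prop :=
  forall U : set Z, nbhs z U -> sf_syndetic mul [set t | U (act t z)].

Definition rel_open (Z : topologicalType) (L U : set Z) : Prop :=
  exists O : set Z, open O /\ U = O `&` L.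

Definition top_transitive_on (T : Type) (Z : topologicalType)
  (act : T -> Z -> Z) (L : set Z) : Prop :=
  forall U V : set Z, rel_open L U -> rel_open L V -> U !=set0 -> V !=set0 ->
    exists t, V `&` (act t @` U) !=set0.

Definition dense_ap_on (T : Type) (mul : T -> T -> T) (Z : topologicalType)
  (act : T -> Z -> Z) (L : set Z) : Prop :=
  exists D : set Z, D `<=` L /\ (forall z, D z -> ap_point mul act z) /\
    L `<=` closure D.

Definition M_semiflow_on (T : Type) (mul : T -> T -> T) (Z : topologicalType)
  (act : T -> Z -> Z) (L : set Z) : Prop :=
  top_transitive_on act L /\ dense_ap_on mul act L.

Definition AP_transitive (T : Type) (mul : T -> T -> T) (X Y : topologicalType)
  (actX : T -> X -> X) (pi : X -> Y) (L : set (X * X)) : Prop :=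
  L !=set0 /\ L `<=` Rpi pi /\
  (forall x, L (x, x)) /\
  (forall x1 x2, L (x1, x2) -> L (x2, x1)) /\
  (forall x1 x2 x3, L (x1, x2) -> L (x2, x3) ->
     ap_point mul (diag_act actX) (x1, x2) ->
     ap_point mul (diag_act actX) (x2, x3) -> L (x1, x3)).

(* RP_{pi|L}: nets (x_j, t_j) are represented by proper filters on
   (X*X) * T; "x_j ∈ L" holds eventually (pass to a tail of the net). *)
Definition RP_rel (T : Type) (X : topologicalType) (actX : T -> X -> X)
  (L : set (X * X)) : set (X * X) :=
  [set p | L p /\
    exists F : set_system ((X * X) * T), ProperFilter F /\
      F [set q | L q.1] /\
      (fun q => q.1) @ F --> p /\
      exists2 p' : X * X, @sf_diagonal X p' &
        (fun q => diag_act actX q.2 q.1) @ F --> p'].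

(* Main.v *)
Require Import Defs.
From HB Require Import structures.
From mathcomp Require Import all_boot all_order.
From mathcomp Require Import all_classical all_reals all_analysis.
Set Implicit Arguments. Unset Strict Implicit. Unset Printing Implicit Defensive.
Local Open Scope classical_set_scope.

(* Let E be the Ellis semigroup of X (the closure of T in X^X), I a minimal left
   ideal of E and u an idempotent of I.  A pair is almost periodic iff it is
   fixed by an idempotent of I, and L restricted to uX x uX is an equivalence
   relation by AP-transitivity.  For topological transitivity, let N be a closed
   invariant subset of L that contains a nonempty relatively open subset U of L;
   it suffices to show that N contains every almost periodic pair of L.
   Up to the action of I, pick (p, q) in L whose orbit meets U, and a target
   (p, z) in L, with p, q, z fixed by u.  Then (q, z) is in L, so regional
   proximality gives nets a_j in I, w_j in uX, t_j in T with (q, w_j) in L,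
   a_j (q, w_j) -> (q, z) and t_j a_j (q, w_j) -> (q, q); let a_j -> r and
   t_j a_j -> r'.  If c is the inverse of u r in the group u I, then c q = q and
   t_j a_j (c p, w_j) -> r' c (p, q), whose orbit meets the open set U.  Hence
   (c p, w_j) is eventually in N, so a_j (c p, w_j) -> (r c p, z) is in N, and
   applying u gives (p, z) in N. *)

(** * Pointwise topology, compactness and minimal closed sets *)

Lemma ptws_eval_continuous (X Z : topologicalType) (x : X) :
  continuous (fun f : {ptws X -> Z} => f x).
Proof. exact: (@proj_continuous X (fun _ => Z) x). Qed.

Lemma continuous_ptws (W X Z : topologicalType) (h : W -> {ptws X -> Z}) :
  (forall x, continuous (fun w => h w x)) -> continuous h.
Proof.
move=> ch w; apply/cvg_sup => x; apply/cvg_image.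
  by rewrite eqEsubset; split=> z // _; exists (fun=> z).
move=> A /= /(ch x w) hA; rewrite nbhs_simpl /=.
exists (@^~ x @^-1` A); first exact: hA.
by rewrite image_preimage // eqEsubset; split=> z // _; exists (fun=> z).
Qed.

Lemma closed_singleton (Z : topologicalType) (z : Z) :
  hausdorff_space Z -> closed [set z].
Proof. by move=> hZ; apply: compact_closed => //; exact: compact_set1. Qed.

Lemma closed_preim (W Z : topologicalType) (f : W -> Z) (A : set Z) :
  continuous f -> closed A -> closed (f @^-1` A).
Proof. by move=> /continuous_closedP; apply. Qed.

Lemma closed_image (W Z : topologicalType) (f : W -> Z) (A : set W) :
  hausdorff_space Z -> compact A -> continuous f -> closed (f @` A).
Proof.
move=> hZ cA cf; apply: compact_closed => //; apply: continuous_compact => //.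
exact: continuous_subspaceT.
Qed.

Lemma hausdorff_prod (W Z : topologicalType) :
  hausdorff_space W -> hausdorff_space Z -> hausdorff_space (W * Z)%type.
Proof.
move=> hW hZ [a b] [c d] cl; congr pair.
- apply: hW => A B nA nB.
  have [||[x y] [/= [? _] [? _]]] := cl (A `*` setT) (B `*` setT); last by exists x.
  + by exists (A, setT) => //=; split => //; exact: filterT.
  + by exists (B, setT) => //=; split => //; exact: filterT.
- apply: hZ => A B nA nB.
  have [||[x y] [/= [_ ?] [_ ?]]] := cl (setT `*` A) (setT `*` B); last by exists y.
  + by exists (setT, A) => //=; split => //; exact: filterT.
  + by exists (setT, B) => //=; split => //; exact: filterT.
Qed.

(** Zorn's lemma is applied to complements within [A]: the union of a chain of complements
    corresponds to an intersection of nested nonempty closed sets, which is nonempty by compactness.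
    It will yield both minimal left ideals and minimal closed subsemigroups. *)
Lemma exists_minimal_closed (Z : topologicalType) (Q : set Z -> Prop) (A : set Z) :
  compact [set: Z] -> (forall B, Q B -> closed B) ->
  (forall F : set (set Z), F `<=` Q -> Q (\bigcap_(B in F) B)) ->
  Q A -> A !=set0 ->
  exists B, [/\ Q B, B !=set0, B `<=` A &
    forall C, Q C -> C !=set0 -> C `<=` B -> C = B].
Proof.
move=> cZ Qcl Qcap QA A0.
pose P (S : set Z) := Q (A `\` S) /\ A `\` S !=set0.
have [F FP Ft|S [[QS S0] Smax]] := @Zorn_bigcup Z P; last first.
  exists (A `\` S); split=> [//|//|z []//|C QC C0 CAS].
  have CA : A `\` ~` C = C.
    by rewrite setDE setCK; apply: setIidr => z /CAS[].
  rewrite eqEsubset; split=> // z [Az nSz]; apply: contrapT => nCz.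
  apply: (Smax (~` C)); last by rewrite /P CA.
  split; last by move=> /(_ _ nCz).
  by move=> x Sx /CAS[].
(* Adding [A] itself keeps the family nonempty when the chain [F] is empty. *)
pose F' := A |` [set A `\` S | S in F].
have F'E : A `\` \bigcup_(S in F) S = \bigcap_(B in F') B.
  rewrite eqEsubset; split=> [z [Az nz] B [->//|[S FS <-]]|z Fz].
    by split=> // Sz; apply: nz; exists S.
  split; first by apply: Fz; left.
  by move=> [S FS Sz]; have [] : (A `\` S) z by apply: Fz; right; exists S.
have F'Q : F' `<=` Q by move=> B [->//|[S FS <-]]; exact: (FP _ FS).1.
have F'0 B : F' B -> B !=set0 by move=> [->//|[S FS <-]]; exact: (FP _ FS).2.
have F'A B : F' B -> B `<=` A by move=> [->//|[S FS <-]] z [].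
have F't B C : F' B -> F' C -> B `<=` C \/ C `<=` B.
  move=> [->|[S FS <-]]; first by right; apply: F'A.
  move=> [->|[S' FS' <-]]; first by left=> z [].
  by have [SS'|SS'] := Ft _ _ FS FS'; [right|left] => z [Az nz];
    split=> // /SS'.
rewrite /P F'E; split; first exact: Qcap.
have FF : Filter (filter_from F' id).
  apply: filter_from_filter; first by exists A; left.
  move=> B C FB FC; have [BC|CB] := F't _ _ FB FC.
    by exists B => // z Bz; split=> //; apply: BC.
  by exists C => // z Cz; split=> //; apply: CB.
have [//||z [_ clz]] := cZ (filter_from F' id).
- exact: filter_from_proper.
- by exists A => //; left.
exists z => B FB; apply: (Qcl _ (F'Q _ FB)) => C Cz.
by apply: clz => //; exists B.
Qed.

Lemma ultra_fmap (W Z : Type) (f : W -> Z) (F : set_system W) :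
  UltraFilter F -> UltraFilter (f @ F).
Proof.
move=> UF; have PF : ProperFilter F by exact: ultra_proper.
split=> [|G PG FG]; first exact: fmap_proper_filter.
rewrite eqEsubset; split=> [A GA|]; last exact: FG.
have [|FnA] := in_ultra_setVsetC (f @^-1` A) UF; first by [].
have /filter_ex[z [? ?]] : G (A `&` ~` A) by apply: filterI => //; exact: FG.
by [].
Qed.

(** * The Ellis semigroup and its action on pairs *)

Definition pair_app (X : Type) (f : X -> X) (p : X * X) : X * X := (f p.1, f p.2).

Section EllisSemigroup.
Context (T : Type) (mul : T -> T -> T) (e : T) (X : topologicalType).
Context (act : T -> X -> X).
Hypothesis flow : semiflow mul e act.
Hypothesis hX : hausdorff_space X.
Hypothesis cX : compact [set: X].

Local Notation XX := {ptws X -> X}.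

Definition ellis : set XX := closure (range (act : T -> XX)).

(** Invariance is asked under [T] only; since [J] is closed and right composition is continuous, it
    extends to all of [ellis]. *)
Definition left_ideal (J : set XX) : Prop :=
  closed J /\ (forall t f, J f -> J (act t \o f)).

Definition minimal_ideal (J : set XX) : Prop :=
  [/\ left_ideal J, J `<=` ellis, J !=set0 &
    forall J', left_ideal J' -> J' !=set0 -> J' `<=` J -> J' = J].

Lemma hausdorff_ptws : hausdorff_space XX.
Proof. exact: (@hausdorff_product X (fun _ => X)). Qed.

Lemma compact_ptws : compact [set: XX].
Proof.
have := @tychonoff X (fun _ => X) (fun _ => setT) (fun _ => cX).
by congr compact; rewrite eqEsubset; split.
Qed.

Lemma closed_compact_ptws (A : set XX) : closed A -> compact A.
Proof. by move=> cA; apply: subclosed_compact compact_ptws _. Qed.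

Lemma comp_right_continuous (g : X -> X) : continuous (fun f : XX => f \o g : XX).
Proof.
by apply: continuous_ptws => x; exact: (@ptws_eval_continuous X X (g x)).
Qed.

Lemma comp_left_continuous t : continuous (fun f : XX => act t \o f : XX).
Proof.
apply: continuous_ptws => x f.
apply: (@continuous_comp _ _ _ (fun f : XX => f x) (act t)).
  exact: ptws_eval_continuous.
by case: flow => _ [_]; apply.
Qed.

Lemma pair_app_continuous (p : X * X) :
  continuous (fun f : XX => pair_app f p).
Proof.
move=> f; apply: (@cvg_pair _ _ _ (nbhs f) (nbhs (f p.1)) (nbhs (f p.2)) _ _ _
  (fun g : XX => g p.1) (fun g : XX => g p.2));
  [exact: (@ptws_eval_continuous X X p.1)|exact: (@ptws_eval_continuous X X p.2)].
Qed.

Lemma diag_act_continuous t : continuous (diag_act act t).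
Proof.
case: flow => _ [_ ca] p; apply: cvg_pair.
  by apply: (@continuous_comp _ _ _ fst); [exact: cvg_fst|exact: ca].
by apply: (@continuous_comp _ _ _ snd); [exact: cvg_snd|exact: ca].
Qed.

Lemma pair_compact_regular (p : X * X) (U : set (X * X)) :
  nbhs p U -> exists2 V, nbhs p V & closure V `<=` U.
Proof.
move=> pU; apply: (@compact_regular _ p setT) => //.
- exact: hausdorff_prod.
- by rewrite -setXTT; exact: compact_setX.
- exact: filterT.
Qed.

Lemma act_ellis t : ellis (act t).
Proof. by apply: subset_closure; exists t. Qed.

Lemma ellis_closed_ind (A : set XX) :
  closed A -> (forall t, A (act t)) -> ellis `<=` A.
Proof.
by move=> cA tA; rewrite /ellis closureE => f; apply; split=> // _ [t _ <-].
Qed.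

Lemma ellis_left_ideal : left_ideal ellis.
Proof.
split=> // [|t f]; first exact: closed_closure.
apply: (@ellis_closed_ind ((fun f : XX => act t \o f : XX) @^-1` ellis)).
  by apply: closed_preim; [exact: comp_left_continuous|exact: closed_closure].
move=> s; rewrite /preimage /=.
suff -> : act t \o act s = act (mul t s) by exact: act_ellis.
by apply/funext => x; case: flow => _ [/(_ t s x)].
Qed.

Lemma left_ideal_comp J f g : left_ideal J -> ellis f -> J g -> J (f \o g).
Proof.
move=> [cJ Jt] Ef Jg.
apply: (ellis_closed_ind (A := (fun f : XX => f \o g : XX) @^-1` J)) Ef.
  by apply: closed_preim => //; exact: comp_right_continuous.
by move=> t; exact: Jt.
Qed.

Lemma ellis_invariant (N : set (X * X)) f p :
  closed N -> sf_invariant (diag_act act) N -> ellis f -> N p -> N (pair_app f p).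
Proof.
move=> cN iN Ef Np.
apply: (ellis_closed_ind (A := (fun f : XX => pair_app f p) @^-1` N)) Ef.
  by apply: closed_preim => //; exact: pair_app_continuous.
by move=> t; exact: iN.
Qed.

(** Returns from limits to [T]: an open condition at [f] persists nearby, where some [act t]
    lies. *)
Lemma ellis_approx (O : set (X * X)) f p :
  open O -> ellis f -> O (pair_app f p) -> exists t, O (diag_act act t p).
Proof.
move=> oO Ef Of; have [|_ [[t _ <-]] Ot] := Ef [set f : XX | O (pair_app f p)].
  by apply: pair_app_continuous; exact: open_nbhs_nbhs.
by exists t.
Qed.

Lemma exists_minimal_ideal : exists J, minimal_ideal J.
Proof.
have [B []//|F FQ|||J [lJ J0 JE Jmin]] :=
  @exists_minimal_closed XX left_ideal ellis compact_ptws.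
- split; first by apply: closed_bigI => B /FQ[].
  by move=> t f Ff B FB; apply: (FQ _ FB).2; exact: Ff.
- exact: ellis_left_ideal.
- by exists (act e); exact: act_ellis.
- by exists J.
Qed.

(** Ellis-Numakura: in a minimal closed subsemigroup [R] containing [u], minimality gives [R u = R],
    so the elements [f] of [R] with [f u = u] form a nonempty closed subsemigroup. It equals [R],
    hence contains [u]. *)
Lemma exists_idempotent (S : set XX) :
  closed S -> S !=set0 -> (forall f g, S f -> S g -> S (f \o g)) ->
  exists2 u, S u & u \o u = u.
Proof.
move=> cS S0 mS.
pose Q (A : set XX) := closed A /\ (forall f g, A f -> A g -> A (f \o g)).
have [B []//|F FQ|||R [[cR mR] [u Ru] RS Rmin]] :=
  @exists_minimal_closed XX Q S compact_ptws.
- split; first by apply: closed_bigI => B /FQ[].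
  by move=> f g Ff Fg B FB; apply: (FQ _ FB).2; [exact: Ff|exact: Fg].
- by [].
- by [].
have Ru_eq : [set f \o u | f in R] = R.
  apply: Rmin; last by move=> _ [f Rf <-]; exact: mR.
    split; last by move=> _ _ [f Rf <-] [g Rg <-]; exists (f \o u \o g) => //;
      apply: (mR _ g) => //; exact: mR.
    apply: closed_image; [exact: hausdorff_ptws|exact: closed_compact_ptws|].
    exact: comp_right_continuous.
  by exists (u \o u), u.
have fix_eq : R `&` [set f : XX | f \o u = u] = R.
  apply: Rmin; last by move=> f [].
    split; last by move=> f g [Rf fu] [Rg gu]; split; [exact: mR|
      rewrite /= -compA gu].
    apply: closedI => //.
    apply: (@closed_preim _ _ (fun f : XX => f \o u : XX) [set u]).
      exact: comp_right_continuous.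
    by apply: closed_singleton; exact: hausdorff_ptws.
  by move: (Ru); rewrite -{1}Ru_eq => -[f Rf fu]; exists f.
by exists u; [exact: RS|move: Ru; rewrite -{1}fix_eq => -[]].
Qed.

(** * Minimal left ideals and almost periodic pairs *)

Section MinimalIdeal.
Context (I : set XX).
Hypothesis mI : minimal_ideal I.

Lemma minimal_ideal_ellis : I `<=` ellis. Proof. by case: mI. Qed.

Lemma minimal_ideal_comp f g : ellis f -> I g -> I (f \o g).
Proof. by case: mI => lI _ _ _; exact: left_ideal_comp. Qed.

(** The set [E f] is a nonempty closed left ideal inside [I], so it is [I] by minimality. This is
    how any motion by an element of [I] is undone later. *)
Lemma minimal_ideal_div f g : I f -> I g -> exists2 h, ellis h & h \o f = g.
Proof.
case: mI => _ _ _ Imin If Ig.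
suff EI : [set h \o f | h in ellis] = I by move: Ig; rewrite -EI => -[h]; exists h.
apply: Imin; last by move=> _ [h Eh <-]; exact: minimal_ideal_comp.
  split.
    apply: closed_image; [exact: hausdorff_ptws| |exact: comp_right_continuous].
    by apply: closed_compact_ptws; exact: closed_closure.
  by move=> t _ [h Eh <-]; exists (act t \o h) => //; apply: ellis_left_ideal.2.
by exists (act e \o f), (act e) => //; exact: act_ellis.
Qed.

Lemma minimal_ideal_idempotent : exists2 u, I u & u \o u = u.
Proof.
case: mI => -[cI _] IE I0 _; apply: exists_idempotent => // f g /IE.
exact: minimal_ideal_comp.
Qed.

Lemma idempotent_right_unit f u : I u -> u \o u = u -> I f -> f \o u = f.
Proof.
by move=> Iu uu If; have [h _ <-] := minimal_ideal_div Iu If; rewrite -compA uu.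
Qed.

(* [u I] is a group with unit [u]; [c] is the inverse of [u f] in it. *)
Lemma minimal_ideal_inverse f u : I u -> u \o u = u -> I f ->
  exists c, [/\ I c, u \o c = c, c \o f = u & u \o f \o c = u].
Proof.
move=> Iu uu If; have IE := minimal_ideal_ellis.
have inv g : I g -> exists c, [/\ I c, u \o c = c & c \o g = u].
  move=> Ig; have Iug : I (u \o g) by apply: minimal_ideal_comp => //; exact: IE.
  have [h Eh hg] := minimal_ideal_div Iug Iu.
  exists (u \o h \o u); split; last by rewrite -[LHS]/(u \o (h \o (u \o g))) hg.
    apply: minimal_ideal_comp (Iu).
    exact: left_ideal_comp ellis_left_ideal (IE _ Iu) Eh.
  by rewrite -[LHS]/((u \o u) \o (h \o u)) uu.
have [c [Ic uc cf]] := inv f If.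
have [d [Id _ dc]] := inv c Ic.
exists c; split=> //.
have du : d \o u = d by exact: idempotent_right_unit.
(* The left inverse [d] of [c] is [u f], because [d = d u = d c f = u f]. *)
suff -> : u \o f = d by [].
by rewrite -[in LHS]dc -[LHS]/(d \o (c \o f)) cf.
Qed.

Lemma minimal_ideal_transitive x y :
  sf_minimal act -> exists2 f, I f & f x = y.
Proof.
case: mI => -[cI It] _ [f If] _ mX.
suff : [set f x | f in I] y by case=> g Ig gx; exists g.
rewrite (mX [set g x | g in I]) //; last by exists (f x), f.
  apply: closed_image => //; first exact: closed_compact_ptws.
  exact: (@ptws_eval_continuous X X x).
by move=> t _ [g Ig <-]; exists (act t \o g) => //; exact: It.
Qed.

(** Syndeticity puts [p] in the closure of [I p], which is closed. The stabilizer of [p] in [I] is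
    then a nonempty closed subsemigroup, so it has an idempotent. *)
Lemma ap_point_idempotent p : ap_point mul (diag_act act) p ->
  exists v, [/\ I v, v \o v = v & pair_app v p = p].
Proof.
move=> ap; have [[cI It] IE I0 _] := mI.
have Ip : [set pair_app f p | f in I] p.
  suff : closure [set pair_app f p | f in I] p.
    apply: closed_image; [exact: hausdorff_prod|exact: closed_compact_ptws|].
    exact: pair_app_continuous.
  move=> U /pair_compact_regular[V /ap[K [fK KV]] VU].
  have [f If] := I0.
  (* Finiteness of [K] makes [A] closed; it contains every [act t], hence all of the Ellis
     semigroup. *)
  pose A := \bigcup_(k in K) [set f : XX | closure V (diag_act act k (pair_app f p))].
  suff [k Kk Vk] : A f.
    exists (diag_act act k (pair_app f p)); split; last exact: VU.
    by exists (act k \o f) => //; exact: It.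
  apply: ellis_closed_ind (IE _ If).
    apply: (@closed_bigcup _ {classic T}) => // k Kk.
    apply: (@closed_preim _ _ (fun f : XX => pair_app f p)
      (diag_act act k @^-1` closure V)); first exact: pair_app_continuous.
    by apply: closed_preim; [exact: diag_act_continuous|exact: closed_closure].
  move=> t; have [k Kk Vk] := KV t; exists k => //=; apply: subset_closure.
  case: flow => _ [am _]; move: Vk.
  by rewrite /= /diag_act /pair_app /= !am.
have [||f g [If fp] [Ig gp]|v [Iv vp] vv] :=
  @exists_idempotent (I `&` [set f : XX | pair_app f p = p]).
- apply: closedI => //.
  apply: (@closed_preim _ _ (fun f : XX => pair_app f p) [set p]).
    exact: pair_app_continuous.
  by apply: closed_singleton; exact: hausdorff_prod.
- by case: Ip => f If fp; exists f.
- split; first by apply: minimal_ideal_comp => //; exact: IE.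
  by rewrite /= -[pair_app _ _]/(pair_app f (pair_app g p)) gp.
- by exists v.
Qed.

(** Every [f] in [I] can be brought back to [u], so some [t] sends [f p] into the given
    neighborhood. Compactness of [I] makes finitely many [t] suffice for all [f], in particular for
    all [act t \o u]. *)
Lemma fixed_ap_point u p : I u -> pair_app u p = p ->
  ap_point mul (diag_act act) p.
Proof.
move=> Iu up U; rewrite nbhsE => -[G [oG Gp] GU].
have [[cI It] IE _ _] := mI.
(* Finite subsets of [T], directed by inclusion: compactness as near covering then gives one finite
   [K]. *)
pose F := filter_from (@finite_set T) (fun K => [set K' | finite_set K' /\ K `<=` K']).
have FF : Filter F.
  apply: filter_from_filter; first by exists set0.
  move=> K K' fK fK'; exists (K `|` K'); first by rewrite finite_setU.
  by move=> K2 [fK2 +]; rewrite subUset => -[KK2 K'K2].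
have /compact_near_coveringP cov := closed_compact_ptws cI.
have [f If|K fK KG] := cov _ F
  (fun K f => exists2 k, K k & G (diag_act act k (pair_app f p))) FF.
  have [h Eh hf] := minimal_ideal_div If Iu.
  have [t Gt] : exists t, G (diag_act act t (pair_app f p)).
    by apply: (ellis_approx oG Eh); rewrite -[pair_app h _]/(pair_app (h \o f) p) hf up.
  exists ([set f : XX | G (diag_act act t (pair_app f p))], [set K | K t]).
    split=> /=.
      apply: (@pair_app_continuous p f [set q | G (diag_act act t q)]).
      by apply: diag_act_continuous; exact: open_nbhs_nbhs.
    by exists [set t] => [|K [_]]; [exact: finite_set1|apply].
  by move=> [g K] /= [Gg Kt]; exists t.
have {}KG := KG K (conj fK (@subset_refl _ K)).
exists K; split=> // t; have [|k Kk Gk] := KG (act t \o u); first exact: It.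
exists k => //; apply: GU; move: Gk.
rewrite -{2}up; case: flow => _ [am _].
by rewrite /= /diag_act /pair_app /= !am.
Qed.

End MinimalIdeal.
End EllisSemigroup.

(** * Regional proximality and invariant subsets of the relation *)

Section TransitiveRelation.
Context (T : Type) (mul : T -> T -> T) (e : T) (X Y : topologicalType).
Context (act : T -> X -> X) (pi : X -> Y) (L : set (X * X)).
Hypothesis flow : semiflow mul e act.
Hypothesis hX : hausdorff_space X.
Hypothesis cX : compact [set: X].
Hypothesis mX : sf_minimal act.
Hypothesis cL : closed L.
Hypothesis iL : sf_invariant (diag_act act) L.
Hypothesis tL : AP_transitive mul act pi L.
Hypothesis dL : dense_ap_on mul (diag_act act) L.
Hypothesis rpL : RP_rel act L = L.

Local Notation XX := {ptws X -> X}.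

(** The diagonal limit [(x, x)] can be steered near [(q, q)] by some [s], by minimality of [X]. All
    conditions being open, density replaces the net point by an almost periodic pair. *)
Lemma RP_ap_approx q z (A B : set (X * X)) :
  L (q, z) -> nbhs (q, z) A -> nbhs (q, q) B ->
  exists2 p, L p /\ ap_point mul (diag_act act) p &
    exists t, A p /\ B (diag_act act t p).
Proof.
move=> Lqz; rewrite !nbhsE => -[A' [oA A'p] A'A] [B' [oB B'q] B'B].
move: (Lqz); rewrite -{1}rpL => -[_ [F [PF [FL [Fp [[x x'] /= xx' Ft]]]]]].
rewrite /sf_diagonal /= in xx'; subst x'.
have [I mI] := exists_minimal_ideal flow cX.
have [f If fx] := minimal_ideal_transitive hX cX mI x q mX.
have [s B's] : exists s, B' (diag_act act s (x, x)).
  apply: (ellis_approx oB (minimal_ideal_ellis mI If)).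
  by rewrite /pair_app /= fx.
have F1 : F [set r | A' r.1] by apply: Fp; exact: open_nbhs_nbhs.
have F2 : F [set r | B' (diag_act act s (diag_act act r.2 r.1))].
  apply: (Ft [set r | B' (diag_act act s r)]).
  by apply: (diag_act_continuous flow); exact: open_nbhs_nbhs.
have [[p0 t] [/= Lp0 [A'p0 B'p0]]] := filter_ex (filterI FL (filterI F1 F2)).
have [D [DL [Dap LD]]] := dL.
have [|p [Dp [A'p1 B'p1]]] :=
  LD _ Lp0 (A' `&` [set r | B' (diag_act act s (diag_act act t r))]).
  apply: filterI; first exact: open_nbhs_nbhs.
  apply: (@diag_act_continuous _ _ _ _ _ flow t p0
    [set r | B' (diag_act act s r)]).
  by apply: (diag_act_continuous flow); exact: open_nbhs_nbhs.
exists p; first by split; [exact: DL|exact: Dap].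
exists (mul s t); split; first exact: A'A.
apply: B'B; move: B'p1; case: flow => _ [am _].
by rewrite /= /diag_act /= !am.
Qed.

Lemma invariant_with_interior_ap (N U : set (X * X)) :
  closed N -> sf_invariant (diag_act act) N -> rel_open L U -> U !=set0 ->
  U `<=` N -> forall p, L p -> ap_point mul (diag_act act) p -> N p.
Proof.
move=> cN iN [G [oG UE]] [y0 Uy0] UN x Lx apx.
have [I mI] := exists_minimal_ideal flow cX.
have [u Iu uu] := minimal_ideal_idempotent hX cX mI.
have IE := minimal_ideal_ellis mI.
have EL f r : ellis act f -> L r -> L (pair_app f r) by exact: ellis_invariant.
have EN f r : ellis act f -> N r -> N (pair_app f r) by exact: ellis_invariant.
have Icomp f g : ellis act f -> I g -> I (f \o g) by exact: minimal_ideal_comp.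
have uuE a : u (u a) = u a by rewrite -[u (u a)]/((u \o u) a) uu.
(* Pairs with coordinates fixed by [u] are almost periodic, so AP-transitivity applies to them. *)
have Ltrans a b c : u a = a -> u b = b -> u c = c -> L (a, b) -> L (b, c) -> L (a, c).
  move=> ua ub uc Lab Lbc; case: tL => _ [_ [_ [_ tr]]].
  by apply: (tr a b c) => //; apply: (fixed_ap_point flow hX cX mI Iu);
    rewrite /pair_app /= ?ua ?ub ?uc.
have Lsym a b : L (a, b) -> L (b, a) by case: tL => _ [_ [_ [sy _]]]; exact: sy.
have [y [Uy apy]] : exists y, U y /\ ap_point mul (diag_act act) y.
  have [D [DL [Dap LD]]] := dL; move: Uy0; rewrite UE => -[Gy0 Ly0].
  have [|y [Dy Gy]] := LD _ Ly0 G; first exact: open_nbhs_nbhs.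
  by exists y; split; [split=> //; exact: DL|exact: Dap].
have Ly : L y by move: Uy; rewrite UE => -[].
have Gy : G y by move: Uy; rewrite UE => -[].
have [v [Iv vv vy]] := ap_point_idempotent flow hX cX mI apy.
(* y = v y is in the orbit closure of (p, q) because v u = v. *)
pose p := u y.1; pose q := u y.2.
have up : u p = p by exact: uuE.
have uq : u q = q by exact: uuE.
have Lpq : L (p, q) by apply: (EL u y) => //; exact: IE.
have vpq : pair_app v (p, q) = y.
  rewrite -[pair_app _ _]/(pair_app (v \o u) y).
  by rewrite (idempotent_right_unit flow hX cX mI Iu uu Iv).
have [w [Iw ww wx]] := ap_point_idempotent flow hX cX mI apx.
have [f0 If0 f0x] := minimal_ideal_transitive hX cX mI x.1 p mX.
(* The factor [u] makes [z] fixed by [u] and leaves the first coordinate at [p]. *)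
pose f := u \o f0.
have If : I f by apply: Icomp => //; exact: IE.
pose z := f x.2.
have fx : pair_app f x = (p, z) by rewrite /pair_app /f /= f0x up.
have uz : u z = z by exact: uuE.
have Lpz : L (p, z) by rewrite -fx; apply: EL => //; exact: IE.
(* As [x = w x], an [h] with [h f w = w] carries [(p, z)] back to [x]. *)
suff Npz : N (p, z).
  have Ifw : I (f \o w) by apply: Icomp => //; exact: IE.
  have [h Eh hfw] := minimal_ideal_div flow hX cX mI Ifw Iw.
  rewrite -wx -hfw -[pair_app _ _]/(pair_app h (pair_app f (pair_app w x))).
  by rewrite wx fx; exact: EN.
have Lqz : L (q, z) by apply: (Ltrans q p z) => //; exact: Lsym.
(* The nets of the header, as an ultrafilter on the triples (a, w, t). *)
pose J := (XX * X * T)%type.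
pose good (j : J) := [/\ I j.1.1, u j.1.2 = j.1.2 & L (q, j.1.2)].
pose src (j : J) : X * X := pair_app j.1.1 (q, j.1.2).
pose tgt (j : J) : X * X := diag_act act j.2 (src j).
pose base (AB : set (X * X) * set (X * X)) :=
  [set j | good j /\ AB.1 (src j) /\ AB.2 (tgt j)].
pose F0 := filter_from
  [set AB : set (X * X) * set (X * X) | nbhs (q, z) AB.1 /\ nbhs (q, q) AB.2] base.
have FF0 : Filter F0.
  apply: filter_from_filter; first by exists (setT, setT); split; exact: filterT.
  move=> [A B] [A' B'] [/= nA nB] [/= nA' nB'].
  exists (A `&` A', B `&` B'); first by split; exact: filterI.
  by move=> j [gj [[? ?] [? ?]]].
have PF0 : ProperFilter F0.
  apply: filter_from_proper => -[A B] [/= nA nB].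
  have [[a b] [Lab apab] [t [Aab Bab]]] := RP_ap_approx Lqz nA nB.
  have [k [Ik kk [ka kb]]] := ap_point_idempotent flow hX cX mI apab.
  have [g0 Ig0 g0q] := minimal_ideal_transitive hX cX mI q a mX.
  pose g := k \o g0.
  have Ig : I g by apply: Icomp => //; exact: IE.
  have gq : g q = a by rewrite /g /= g0q.
  (* The triple will be [(g, c b, t)]. Here [c a = c g q = u q = q], so [(q, c b)] is in [L]; and
     [g c = k u g c = k u = k] fixes [b]. *)
  have [c [Ic uc cg ugc]] := minimal_ideal_inverse flow hX cX mI Iu uu Ig.
  have gcb : g (c b) = b.
    have kug : k \o u \o g = g.
      by rewrite (idempotent_right_unit flow hX cX mI Iu uu Ik) /g compA kk.
    rewrite -kug -[LHS]/(k ((u \o g \o c) b)) ugc -[LHS]/((k \o u) b).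
    by rewrite (idempotent_right_unit flow hX cX mI Iu uu Ik).
  have srcE : pair_app g (q, c b) = (a, b) by rewrite /pair_app /= gq gcb.
  exists (g, c b, t); split; last by rewrite /tgt /src /= srcE.
  split=> //=; first by rewrite -[LHS]/((u \o c) b) uc.
  have -> : (q, c b) = pair_app c (a, b).
    by rewrite /pair_app /= -gq -[c (g q)]/((c \o g) q) cg uq.
  by apply: EL => //; exact: IE.
(* Along an ultrafilter, maps into the compact set [I] converge without passing to subnets. *)
have [F [UF F0F]] := ultraFilterLemma PF0.
have PF : ProperFilter F by exact: ultra_proper.
have Fgood : F good by apply: F0F; exists (setT, setT);
  [split; exact: filterT|move=> j []].
have srcF : src @ F --> (q, z).
  move=> A nA; apply: F0F; exists (A, setT); first by split=> //; exact: filterT.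
  by move=> j [_ [? _]].
have tgtF : tgt @ F --> (q, q).
  move=> B nB; apply: F0F; exists (setT, B); first by split=> //; exact: filterT.
  by move=> j [_ [_ ?]].
have limI (h : J -> XX) : F [set j | I (h j)] -> exists2 r : XX, I r & h @ F --> r.
  move=> FI; have cI : compact I by apply: closed_compact_ptws => //; case: mI => -[].
  have UhF : UltraFilter (h @ F) by exact: ultra_fmap.
  move: cI; rewrite compact_ultra => /(_ _ UhF FI)[r [Ir hr]].
  by exists r.
have evalF (h : J -> XX) (r : XX) a : h @ F --> r -> (fun j => h j a) @ F --> r a.
  move=> hr; apply: (@cvg_comp _ _ _ h (fun f : XX => f a) F (nbhs r)) => //.
  exact: (@ptws_eval_continuous X X a).
have uniq_lim (h : J -> X) (a b : X) : h @ F --> a -> h @ F --> b -> a = b.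
  by move=> ha hb; exact: (cvg_unique hX ha hb).
have [r Ir rF] : exists2 r : XX, I r & (fun j : J => j.1.1) @ F --> r.
  by apply: limI; apply: filterS Fgood => j [].
have [r' Ir' r'F] : exists2 r : XX, I r & (fun j : J => act j.2 \o j.1.1 : XX) @ F --> r.
  apply: limI; apply: filterS Fgood => j [Ij _ _].
  by apply: Icomp => //; exact: act_ellis.
have fstF (h : J -> X * X) (a b : X) : h @ F --> (a, b) -> (fun j => (h j).1) @ F --> a.
  by move=> hab; apply: (@cvg_comp _ _ _ h fst _ _ _ hab); exact: cvg_fst.
have sndF (h : J -> X * X) (a b : X) : h @ F --> (a, b) -> (fun j => (h j).2) @ F --> b.
  by move=> hab; apply: (@cvg_comp _ _ _ h snd _ _ _ hab); exact: cvg_snd.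
(* The first coordinates of [src] and [tgt] are evaluations at [q], and both tend to [q]. *)
have rq : r q = q by apply: uniq_lim (evalF _ _ q rF) (fstF _ _ _ srcF).
have r'q : r' q = q by apply: uniq_lim (evalF _ _ q r'F) (fstF _ _ _ tgtF).
have [c [Ic uc cr urc]] := minimal_ideal_inverse flow hX cX mI Iu uu Ir.
have cq : c q = q by rewrite -{1}rq -[LHS]/((c \o r) q) cr.
have ucp : u (c p) = c p by rewrite -[LHS]/((u \o c) p) uc.
have Lcpq : L (c p, q).
  by rewrite -{1}cq; apply: (EL c (p, q)) => //; exact: IE.
have Fr'p : (fun j => (act j.2 (j.1.1 (c p)), (tgt j).2)) @ F --> (r' (c p), q).
  apply: cvg_pair; first exact: (evalF _ _ (c p) r'F).
  exact: sndF tgtF.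
have [s Gs] : exists s, G (diag_act act s (r' (c p), q)).
  have Ir'c : I (r' \o c) by apply: Icomp => //; exact: IE.
  (* Dividing [v] by [r' c] sends [(r' c p, q)] to [v (p, q) = y], which lies in [G]. *)
  have [h Eh hr'c] := minimal_ideal_div flow hX cX mI Ir'c Iv.
  apply: (ellis_approx oG Eh).
  have -> : (r' (c p), q) = pair_app (r' \o c) (p, q).
    by rewrite /pair_app /= cq r'q.
  by rewrite -[pair_app h _]/(pair_app (h \o (r' \o c)) (p, q)) hr'c vpq.
have FN : \forall j \near F, N (c p, j.1.2).
  have Gnear : F [set j | G (diag_act act s (act j.2 (j.1.1 (c p)), (tgt j).2))].
    apply: (Fr'p [set b | G (diag_act act s b)]).
    by apply: (diag_act_continuous flow); exact: open_nbhs_nbhs.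
  apply: filterS (filterI Fgood Gnear) => j [[Ij uj Lj] Gj].
  have Lcj : L (c p, j.1.2) by apply: (Ltrans _ q).
  pose m := act s \o (act j.2 \o j.1.1).
  have Em : I m.
    by exact: (Icomp _ _ (@act_ellis _ _ act s) (Icomp _ _ (@act_ellis _ _ act j.2) Ij)).
  (* [N] is only forward invariant; since [h m = u] fixes [(c p, w_j)], membership of its image
     under [m] passes back to the pair itself. *)
  have [h Eh hm] := minimal_ideal_div flow hX cX mI Em Iu.
  have -> : (c p, j.1.2) = pair_app h (pair_app m (c p, j.1.2)).
    by rewrite -[RHS]/(pair_app (h \o m) (c p, j.1.2)) hm /pair_app /= ucp uj.
  apply: EN => //; apply: UN; rewrite UE; split; first exact: Gj.
  by apply: EL => //; exact: IE.
have Nrcpz : N (r (c p), z).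
  have cvg : (fun j : J => (j.1.1 (c p), (src j).2)) @ F --> (r (c p), z).
    by apply: cvg_pair; [exact: (evalF _ _ (c p) rF)|exact: sndF srcF].
  apply: (closed_cvg N cN _ _ cvg).
  apply: filterS (filterI Fgood FN) => j [[Ij _ _] Nj].
  by apply: (EN _ (c p, j.1.2)) => //; exact: IE.
(* Here [u r c = u] restores [p], while [u] fixes [z]. *)
have := EN u _ (IE _ Iu) Nrcpz.
rewrite /pair_app /= uz.
by rewrite -[u (r (c p))]/((u \o r \o c) p) urc up.
Qed.
End TransitiveRelation.

(** * Topological transitivity *)

Theorem theorem2p2 (T : Type) (mul : T -> T -> T) (e : T)
  (X Y : topologicalType) (actX : T -> X -> X) (actY : T -> Y -> Y)
  (pi : X -> Y) (L : set (X * X)) :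
  monoid_axioms mul e ->
  hausdorff_space X -> compact [set: X] ->
  hausdorff_space Y -> compact [set: Y] ->
  semiflow mul e actX -> semiflow mul e actY ->
  sf_minimal actX -> sf_minimal actY ->
  sf_extension actX actY pi ->
  closed L -> sf_invariant (diag_act actX) L ->
  AP_transitive mul actX pi L ->
  dense_ap_on mul (diag_act actX) L ->
  RP_rel actX L = L ->
  M_semiflow_on mul (diag_act actX) L.
Proof.
move=> _ hX cX _ _ flow _ mX _ _ cL iL tL dL rpL.
split=> // U V oU [G [oG VE]] U0 [z Vz].
apply: contrapT => noreturn.
have [act1 [actM _]] := flow.
(* The points of [L] whose orbits avoid [G]. It contains [U] if no translate of [U] meets [V], hence
   all almost periodic pairs of [L], and by density [z]; but [z] is in [G] at time [e]. *)
pose N := L `&` \bigcap_t [set p | ~ G (diag_act actX t p)].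
have cN : closed N.
  apply: closedI => //; apply: closed_bigI => t _.
  apply: (@closed_preim _ _ (diag_act actX t) (~` G)); last exact: open_closedC.
  exact: diag_act_continuous flow t.
have iN : sf_invariant (diag_act actX) N.
  move=> t p [Lp Np]; split; first exact: iL.
  move=> s _ /=; have := Np (mul s t) I.
  by rewrite /diag_act /= !actM.
have UN : U `<=` N.
  move=> p Up; have Lp : L p by case: oU Up => H [_ ->] [].
  split=> // t _ /= Gp; apply: noreturn; exists t, (diag_act actX t p).
  by split; [rewrite VE; split=> //; exact: iL|exists p].
have [D [DL [Dap LD]]] := dL.
move: Vz; rewrite VE => -[Gz Lz].
have [] : N z.
  apply: (cN); apply: (closureS _ (LD _ Lz)) => p Dp.
  apply: (invariant_with_interior_ap flow hX cX mX cL iL tL dL rpL cN iN oU U0 UN).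
    exact: DL.
  exact: Dap.
move=> _ /(_ e I) /=; apply.
by rewrite /diag_act !act1; case: z Gz {Lz}.
Qed.
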